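(* Let $I=[a,b]$ be a compact interval in $\mathbb R$ and let $g:I\to\mathbb R$ and $f:I\to\mathbb R$ be arbitrary functions. If one of the Riemann--Stieltjes integrals $\int_I g\,df$ and $\int_I f\,dg$ exists, then the other one exists as well, and $$\int_I g\,df+\int_I f\,dg = g(b)f(b)-g(a)f(a).$$
   Context: For arbitrary functions $g,f:[a,b]\to\mathbb R$, the Riemann--Stieltjes integral $\int_a^b g\,df$ is the limit, as $\delta:=\max_k|t_k-t_{k-1}|\to0$, of the sums $\sum_{k=1}^p g(\tau_k)\,(f(t_k)-f(t_{k-1}))$ over partitions $a=t_0\le t_1\le\dots\le t_p=b$ and points $\tau_k\in[t_{k-1},t_k]$; it is said to exist if a finite limit exists, uniform with respect to the partitions and the intermediate points (that is, there is $A\in\mathbb R$ such that for every $\varepsilon>0$ there is $\delta>0$ with $|\sum_k g(\tau_k)(f(t_k)-f(t_{k-1}))-A|<\varepsilon$ for all partitions with $|t_k-t_{k-1}|\le\delta$ for all $k$ and all choices of $\tau_k$). No monotonicity, boundedness or bounded variation is assumed. *)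

(* Defs.v *)
(* MathComp-Analysis: the real numbers are an arbitrary [R : realType]. *)
From mathcomp Require Import all_boot all_order all_algebra.
From mathcomp Require Import boolp classical_sets reals.

Set Implicit Arguments.
Unset Strict Implicit.
Unset Printing Implicit Defensive.

Import Order.TTheory GRing.Theory Num.Theory.

Local Open Scope ring_scope.

(* Only t 0, ..., t p and tau 0, ..., tau (p - 1) matter; the tag of the
   interval [t k, t (k + 1)] is numbered k, not k + 1. *)
Definition tagged_partition (R : realType) (a b : R) (p : nat)
    (t tau : nat -> R) : Prop :=
  [/\ (0 < p)%N, t 0%N = a, t p = b,
      forall k, (k < p)%N -> t k <= t k.+1 &
      forall k, (k < p)%N -> t k <= tau k <= t k.+1].

Definition RS_sum (R : realType) (g f : R -> R) (p : nat)
    (t tau : nat -> R) : R :=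
  \sum_(k < p) g (tau k) * (f (t k.+1) - f (t k)).

(* The points t k and tau k lie in [a, b], so only the restrictions of g and f
   to [a, b] are involved. *)
Definition is_RS_integral (R : realType) (a b : R) (g f : R -> R) (A : R) :
    Prop :=
  forall e : R, 0 < e -> exists2 d : R, 0 < d &
    forall (p : nat) (t tau : nat -> R), tagged_partition a b p t tau ->
      (forall k, (k < p)%N -> `|t k.+1 - t k| <= d) ->
      `|RS_sum g f p t tau - A| < e.

Definition RS_integrable (R : realType) (a b : R) (g f : R -> R) : Prop :=
  exists A : R, is_RS_integral a b g f A.

(* For a <= b there is at most one A with [is_RS_integral a b g f A]; the value
   is meaningful only when [RS_integrable a b g f] holds. *)
Definition RS_integral (R : realType) (a b : R) (g f : R -> R) : R :=
  xget 0 [set A | is_RS_integral a b g f A]%classic.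

(* Main.v *)
(* Exchange division points and tags: for a tagged partition (t, tau), the
   points a <= tau 0 <= ... <= tau (p - 1) <= b tagged by t 0, ..., t p form
   a tagged partition whose mesh is at most twice that of t. Abel summation says
   that the sum for (f, g) over the former plus the sum for (g, f) over the
   latter is exactly g b * f b - g a * f a. *)
Require Import Defs.
From mathcomp Require Import all_boot all_order all_algebra.
From mathcomp Require Import boolp classical_sets reals.
From mathcomp Require Import ring lra.

Import Order.TTheory GRing.Theory Num.Theory.

Local Open Scope ring_scope.

(** Abel summation by induction: the new terms [v p.+1 * (u p.+1 - u p)] and
    [u p.+1 * (v p.+2 - v p.+1)] add up to [u p.+1 * v p.+2 - u p * v p.+1]. *)
Lemma sum_by_parts {R : comPzRingType} (u v : nat -> R) (p : nat) :
  \sum_(k < p) v k.+1 * (u k.+1 - u k) + \sum_(k < p.+1) u k * (v k.+1 - v k)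
  = u p * v p.+1 - u 0%N * v 0%N.
Proof.
elim: p => [|p IHp]; first by rewrite big_ord0 add0r big_ord1 mulrBr.
rewrite [X in X + _]big_ord_recr [X in _ + X]big_ord_recr addrACA IHp /=.
by ring.
Qed.

(** The shift by one makes room for [a]; every index beyond [p] gives [b]. *)
Definition dual_points {R : realType} (a b : R) (p : nat) (tau : nat -> R)
    (k : nat) : R :=
  if k is j.+1 then (if (j < p)%N then tau j else b) else a.

Lemma dual_tagged_partition {R : realType} {a b : R} {p : nat} {t tau : nat -> R} :
  tagged_partition a b p t tau ->
  tagged_partition a b p.+1 (dual_points a b p tau) t.
Proof.
move=> [_ t0 tp _ ttau]; set s := dual_points a b p tau.
(* This interlacing is the tag condition for the new partition, and by transitivity it also makes
   [s] monotone. *)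
have st k : (k < p.+1)%N -> s k <= t k <= s k.+1.
  rewrite ltnS => kp; apply/andP; split.
    case: k kp => [|k] kp; first by rewrite /s /= t0.
    by rewrite /s /= kp; case/andP: (ttau k kp).
  rewrite /s /=; case: ltnP => [/ttau/andP[-> _] //|pk].
  have -> : k = p by apply/eqP; rewrite eqn_leq kp.
  by rewrite tp.
split=> //; first by rewrite /s /= ltnn.
by move=> k /st/andP[]; apply: le_trans.
Qed.

(** Consecutive tags lie in adjacent intervals of [t], so their distance is at most two lengths
    [d / 2]; the first and last gaps fit in one interval each. *)
Lemma dual_mesh {R : realType} {a b : R} {p : nat} {t tau : nat -> R}
    {d : R} :
  tagged_partition a b p t tau ->
  (forall k, (k < p)%N -> `|t k.+1 - t k| <= d / 2) ->
  forall k, (k < p.+1)%N ->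
    `|dual_points a b p tau k.+1 - dual_points a b p tau k| <= d.
Proof.
move=> tagged mesh k kp.
have [_ _ _ smono _] := dual_tagged_partition tagged.
have := smono _ kp; rewrite -subr_ge0 => /ger0_norm ->.
case: tagged => p0 t0 tp _ ttau.
have tail j : (j < p)%N -> [/\ t j <= tau j, tau j <= t j.+1 &
    t j.+1 - t j <= d / 2].
  move=> jp; have /andP[-> ->] := ttau j jp; split=> //.
  exact: le_trans (ler_norm _) (mesh j jp).
rewrite /=; case: k kp => [|k] kp /=.
  by rewrite p0; have [] := tail 0%N p0; rewrite t0; lra.
rewrite ltnS in kp; rewrite kp; have [] := tail k kp.
case: ltnP => [/tail[]|pk]; first by lra.
have -> : k.+1 = p by apply/eqP; rewrite eqn_leq pk andbT.
by rewrite tp; lra.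
Qed.

Lemma RS_sum_dual {R : realType} {a b : R} {p : nat} {t tau : nat -> R}
    (g f : R -> R) :
  tagged_partition a b p t tau ->
  RS_sum f g p t tau + RS_sum g f p.+1 (dual_points a b p tau) t
  = g b * f b - g a * f a.
Proof.
move=> [_ t0 tp _ _].
have := sum_by_parts (g \o t) (f \o dual_points a b p tau) p.
rewrite /= t0 tp ltnn => <-; congr (_ + _).
by apply: eq_bigr => k _; rewrite /= ltn_ord.
Qed.

(** As the identity between the two sums is exact, their errors differ only in sign. *)
Lemma is_RS_integral_by_parts {R : realType} {a b : R} {g f : R -> R} {A : R} :
  is_RS_integral a b g f A ->
  is_RS_integral a b f g (g b * f b - g a * f a - A).
Proof.
move=> gfA e e0; have [d d0 gfd] := gfA e e0.
exists (d / 2) => [|p t tau tagged mesh]; first by rewrite divr_gt0.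
rewrite -(RS_sum_dual g f tagged) -addrA opprD addrA subrr add0r.
by rewrite normrN; apply: gfd (dual_tagged_partition tagged) (dual_mesh tagged mesh).
Qed.

(** Needed for uniqueness of the integral: with no fine partition, every number would be a limit
    vacuously. *)
Lemma exists_fine_partition {R : realType} {a b d : R} : a <= b -> 0 < d ->
  exists p t tau, tagged_partition a b p t tau /\
    forall k, (k < p)%N -> `|t k.+1 - t k| <= d.
Proof.
move=> ab d0.
(* The successor makes [n] exceed [(b - a) / d] and stay positive when [a = b]. *)
pose n := (Num.truncn ((b - a) / d)).+1.
have n0 : 0 < n%:R :> R by rewrite ltr0n.
have nd : (b - a) / n%:R <= d.
  rewrite ler_pdivrMr// mulrC -ler_pdivrMr//.
  by apply/ltW; rewrite truncnS_gt.
have h0 : 0 <= (b - a) / n%:R by rewrite divr_ge0 ?subr_ge0// ltW.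
pose t k := a + (b - a) / n%:R *+ k.
have tS k : t k.+1 - t k = (b - a) / n%:R by rewrite /t mulrSr; ring.
have tmono k : t k <= t k.+1 by rewrite -subr_ge0 tS.
exists n, t, t; split; last by move=> k _; rewrite tS ger0_norm.
split=> //; first by rewrite /t mulr0n addr0.
- by rewrite /t -mulr_natr divfK ?gt_eqF// addrC subrK.
- by move=> k _; rewrite lexx tmono.
Qed.

Lemma is_RS_integral_unique {R : realType} {a b : R} {g f : R -> R} {A B : R} :
  a <= b -> is_RS_integral a b g f A -> is_RS_integral a b g f B -> A = B.
Proof.
move=> ab gfA gfB; apply/eqP; rewrite -subr_eq0 -normr_le0.
apply/ler_addgt0Pr => e e0; rewrite add0r.
have e20 : 0 < e / 2 by rewrite divr_gt0.
have [d1 d10 gf1] := gfA _ e20; have [d2 d20 gf2] := gfB _ e20.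
have d0 : 0 < Num.min d1 d2 by rewrite lt_min d10.
have [p [t [tau [tagged mesh]]]] := exists_fine_partition ab d0.
have SA : `|RS_sum g f p t tau - A| < e / 2.
  by apply: gf1 => // k /mesh; rewrite le_min => /andP[].
have SB : `|RS_sum g f p t tau - B| < e / 2.
  by apply: gf2 => // k /mesh; rewrite le_min => /andP[].
rewrite [e]splitr; apply/ltW.
by apply: le_lt_trans (ler_distD (RS_sum g f p t tau) _ _) _; rewrite ltrD// distrC.
Qed.

Lemma RS_integralE {R : realType} {a b : R} {g f : R -> R} {A : R} :
  a <= b -> is_RS_integral a b g f A -> RS_integral a b g f = A.
Proof.
move=> ab gfA; apply: xget_unique => // B gfB.
exact: is_RS_integral_unique gfB gfA.
Qed.

Theorem lemma1 (R : realType) (a b : R) (hab : a <= b) (g f : R -> R) :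
  RS_integrable a b g f \/ RS_integrable a b f g ->
  [/\ RS_integrable a b g f, RS_integrable a b f g &
      RS_integral a b g f + RS_integral a b f g = g b * f b - g a * f a].
Proof.
(* The claim is symmetric in [g] and [f], up to commutativity. *)
wlog [A gfA] : g f / RS_integrable a b g f => [wlog_gf|_].
  case=> [gf|fg]; first by apply: wlog_gf => //; left.
  have [|? ? E] := wlog_gf f g fg; first by left.
  by split=> //; rewrite addrC E (mulrC (f b)) (mulrC (f a)).
have fgB := is_RS_integral_by_parts gfA.
split; [by exists A | by eexists; exact: fgB |].
by rewrite (RS_integralE hab gfA) (RS_integralE hab fgB) addrC subrK.
Qed.
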